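(* For every (proper) monomial ideal $I\subset R=K[x_1,\ldots,x_n]$, we have $\mathrm{v}(I(\mathrm{pol}))\le \mathrm{v}(I)$. Moreover, if $I$ has no embedded prime, then $\mathrm{v}(I(\mathrm{pol}))=\mathrm{v}(I)$.
   Context: $K$ is a field and polynomial rings over $K$ have the standard grading; $R_d$ denotes the degree-$d$ homogeneous component of a polynomial ring $R$. $\mathrm{Ass}(I)=\mathrm{Ass}(R/I)$ is the set of associated primes of $I$; an embedded prime of $I$ is an associated prime that is not minimal in $\mathrm{Ass}(I)$ under inclusion. For a proper graded ideal $I$ of $R$, its v-number is $\mathrm{v}(I)=\min\{d\ge 0 : \exists f\in R_d \text{ and } \mathfrak{p}\in\mathrm{Ass}(I)\text{ with } (I:f)=\mathfrak{p}\}$. For a monomial $\mathbf{x}^{\mathbf{a}}=x_1^{a_1}\cdots x_n^{a_n}$, its polarization is $\mathbf{x}^{\mathbf{a}}(\mathrm{pol})=\prod_{i=1}^n\prod_{j=1}^{a_i}x_{i,j}$. For a monomial ideal $I$ with minimal monomial generating set $G(I)$, $I(\mathrm{pol})$ is the square-free monomial ideal generated by $\{u(\mathrm{pol}):u\in G(I)\}$ in $R(\mathrm{pol})=K[x_{i,j}: 1\le i\le n,\ 1\le j\le r_i]$, where $r_i$ is the exponent of $x_i$ in the lcm of the elements of $G(I)$. *)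

(* Defs.v *)
(* Ideals are boolean predicates; classical logic (boolp) makes every subset of
   a ring available as one. *)
From mathcomp Require Import all_boot all_order all_algebra.
From mathcomp Require Import ring_quotient boolp mpoly.

Set Implicit Arguments.
Unset Strict Implicit.
Unset Printing Implicit Defensive.

Import GRing.Theory.
Local Open Scope ring_scope.

Section Ideals.
Context {R : comNzRingType}.
Implicit Types (S I P : {pred R}) (f g : R).

Definition ideal_gen S : {pred R} :=
  [pred p : R | `[< exists s : seq (R * R),
     {in s, forall c, c.2 \in S} /\ p = \sum_(c <- s) c.1 * c.2 >]].

(* idealr_closed already requires 1 \notin P. *)
Definition prime_ideal P : Prop := idealr_closed P /\ prime_idealr_closed P.

Definition colon I f : {pred R} := [pred g : R | g * f \in I].

(* The annihilator of the class of f in R / I is (I : f). *)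
Definition assoc_prime I P : Prop := prime_ideal P /\ exists f, P =i colon I f.

Definition minimal_assoc_prime I P : Prop :=
  assoc_prime I P /\
  forall Q : {pred R}, assoc_prime I Q -> {subset Q <= P} -> Q =i P.

Definition embedded_prime I P : Prop :=
  assoc_prime I P /\ ~ minimal_assoc_prime I P.

End Ideals.

Section VNumber.
Context {K : fieldType} {n : nat}.
Implicit Type I : {pred {mpoly K[n]}}.

Definition v_degree I : pred nat := fun d =>
  `[< exists (f : {mpoly K[n]}) (P : {pred {mpoly K[n]}}),
      [/\ f \is d.-homog, assoc_prime I P & colon I f =i P] >].

(* The set of such degrees is nonempty for every proper graded ideal, so the
   value 0 of the second branch is never used for those. *)
Definition v_number I : nat :=
  if pselect (exists d, v_degree I d) is left ex then ex_minn ex else 0%N.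

End VNumber.

Section Monomial.
Context {K : fieldType} {n : nat}.
Implicit Types (I : {pred {mpoly K[n]}}) (G : seq 'X_{1..n}).

Definition monomial_ideal I : Prop :=
  exists M : {pred {mpoly K[n]}},
    (forall u, u \in M -> exists m : 'X_{1..n}, u = 'X_[m]) /\ I =i ideal_gen M.

Definition generates G I : Prop :=
  I =i ideal_gen (mem [seq 'X_[m] : {mpoly K[n]} | m <- G]).

Definition is_min_gens I G : Prop :=
  [/\ uniq G, generates G I &
      forall G', {subset G' <= G} -> generates G' I -> {subset G <= G'}].

(* G(I), listed in some order. By Dickson's lemma a monomial ideal has such a
   finite generating set, which is unique as a set; the second branch only
   concerns ideals that are not monomial. *)
Definition min_gens I : seq 'X_{1..n} :=
  if pselect (exists G, is_min_gens I G) is left ex then projT1 (cid ex)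
  else [::].

Definition gens_lcm I : 'X_{1..n} :=
  \big[@mlcm n/0%MM]_(m <- min_gens I) m.

(* Indices (i, j) of the variables of R(pol), with j counted from 0. *)
Definition pol_var I : finType := {i : 'I_n & 'I_(gens_lcm I i)}.

Definition pol_X I (i : 'I_n) (j : 'I_(gens_lcm I i)) : {mpoly K[#|pol_var I|]} :=
  'X_(enum_rank (Tagged (fun i => 'I_(gens_lcm I i)) j : pol_var I)).

(* The inner product runs over all j < m i as soon as 'X_[m] divides the lcm
   of G(I), in particular for m in G(I). *)
Definition pol_monomial I (m : 'X_{1..n}) : {mpoly K[#|pol_var I|]} :=
  \prod_(i < n) \prod_(j < gens_lcm I i | (j < m i)%N) pol_X j.

Definition polarization I : {pred {mpoly K[#|pol_var I|]}} :=
  ideal_gen (mem [seq pol_monomial I m | m <- min_gens I]).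

End Monomial.

Arguments polarization {K n} I _.

(* Main.v *)
Require Import Defs.
From mathcomp Require Import all_boot all_order all_algebra.
From mathcomp Require Import ring_quotient boolp mpoly.
From mathcomp Require Import zify.

Set Implicit Arguments.
Unset Strict Implicit.
Unset Printing Implicit Defensive.

Import GRing.Theory.
Local Open Scope ring_scope.

(** Everything reduces to a statement about exponent vectors.

  Let [M] be the set of exponents of the monomials of [I].  If [(I : f)] is
  prime for a homogeneous [f] of degree [d], then some monomial [x^u] of [f]
  already has a prime colon ideal, generated by variables: with [S] the set of
  variables in [(I : f)], if every monomial of [f] were sent into [I] by a
  monomial avoiding [S], the product of these multipliers would lie in
  [(I : f)] without involving [S] (witness_of_colon).  So the v-number is the
  least degree of a [u] such that, for some [S], multiplying by any variable
  of [S] leads from [u] into [M], while no monomial avoiding [S] does: this is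
  [witness M u S] (v_number_witness).

  A monomial [y^b] in the variables [x_{i,j}] lies in the polarization iff
  [x^(depol b)] lies in [I], where [depol b] records, for each [i], how many of
  [x_{i,0}, x_{i,1}, ...] divide [y^b] before the first one that does not
  (mons_polarization).  Hence the two inequalities.

  - If [(u, S)] is a witness for [I], then [b = prod_{j < u_i} x_{i,j}] with
    [T = { x_{i,u_i} : i in S }] is one for the polarization, and its degree is
    at most that of [u] (polarize_witness).

  - Let [(b, T)] be a witness for the polarization.  Only [x_{i,j}] with
    [j = depol b i] change [depol b], so [T] selects one variable for each
    index of a set [S].  In the colon ideal [J = (I : x^(depol b))], a power of
    each [x_i] with [i in S] occurs, and no monomial avoiding [S] does; hence
    [(x_i : i in S)] is the minimal prime over [J], and it is associated to [I].
    Every associated prime of [J] is associated to [I] and contains it, so it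
    is the only one when [I] has no embedded prime, and [J] is primary.
    Therefore any [u >= depol b] outside [M] stays outside [M] after
    multiplication by monomials avoiding [S].  Take such a [u] maximal with
    [u_i <= deg of b in the x_{i,j}] for each [i]; then [(u, S)] is a witness
    of degree at most [deg b] (depolarize_witness).

  Throughout, membership in [M] depends only on exponents truncated at those of
  the lcm of the generators.  This gives witnesses above any [u] outside [M]:
  raise [u] as far as possible outside [M] within a box (witness_above), which
  plays the part of the existence of associated primes. *)

(** * Associated primes in terms of exponent vectors *)

Section Witness.
Variable n : nat.
Implicit Types (M : pred 'X_{1..n}) (r u v w a : 'X_{1..n}) (S : {set 'I_n}).
Local Open Scope nat_scope.

(** Exponents truncated at [r] decide membership in [M]; taking [u <= v] this
  includes stability of [M] under multiplication by monomials. *)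
Definition closed_mod r M :=
  forall u v, (forall i, minn (u i) (r i) <= v i) -> M u -> M v.

(** For [M] the exponents of a monomial ideal [I], this is the equality of
  [(I : x^u)] with the prime ideal generated by the variables in [S]. *)
Definition witness M u S :=
  (forall i, i \in S -> M (u + U_(i))%MM) /\
  (forall a, (forall i, i \in S -> a i = 0) -> ~~ M (u + a)%MM).

Lemma closed_mod_le r M u v : closed_mod r M -> (u <= v)%MM -> M u -> M v.
Proof.
move=> cM /mnm_lepP uv; apply: cM => i; exact: leq_trans (geq_minl _ _) (uv i).
Qed.

Lemma witness_notin M u S : witness M u S -> ~~ M u.
Proof. by case=> _ /(_ 0%MM); rewrite addm0; apply=> i _; rewrite mnm0E. Qed.

Lemma box_maximal (P : pred 'X_{1..n}) w b : (w <= b)%MM -> P w ->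
  exists u, [/\ (w <= u)%MM, (u <= b)%MM, P u &
    forall i, u i < b i -> ~~ P (u + U_(i))%MM].
Proof.
elim: {w}_.+1 {-2}w (ltnSn (mdeg b - mdeg w)) => // k IHk w lek wb Pw.
case: (pselect (exists i, (w i < b i) && P (w + U_(i))%MM)) => [[i /andP[lti Pi]]|].
  have wb' : (w + U_(i) <= b)%MM.
    apply/mnm_lepP => j; rewrite mnmDE mnm1E; case: eqP => [<-|_].
      by rewrite addn1.
    by rewrite addn0; apply: (mnm_lepP wb).
  have dle : mdeg (w + U_(i)) <= mdeg b.
    by rewrite !mdegE; apply: leq_sum => j _; apply: (mnm_lepP wb').
  rewrite mdegD mdeg1 in dle.
  have [|u [wu ub Pu umax]] := IHk (w + U_(i))%MM _ wb' Pi.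
    by rewrite mdegD mdeg1; lia.
  by exists u; split=> //; apply: lepm_trans wu; apply: lem_addr.
move=> nex; exists w; split=> // [|i lti]; first exact: lepm_refl.
by apply/negP => Pi; apply: nex; exists i; rewrite lti.
Qed.

(** Choose [u] maximal outside [M] in the box from [w] to the lcm of [w] and
  [r], and let [S] collect the coordinates below [r]: raising one of these
  stays in the box, so it enters [M], while raising the others is invisible
  after truncation at [r]. *)
Lemma witness_above r M w : closed_mod r M -> ~~ M w ->
  exists u S, (w <= u)%MM /\ witness M u S.
Proof.
move=> cM Mw.
have [u [wu ub Mu umax]] :=
  box_maximal (P := fun u => ~~ M u) (lem_mlcml w r) Mw.
exists u, [set i | u i < r i]; split=> //; split=> [i|a a0].
  rewrite inE => lti; apply/negbNE/umax.
  by rewrite mnmE (leq_trans lti) ?leq_maxr.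
apply: contra Mu; apply: cM => i; rewrite mnmDE.
case: (ltnP (u i) (r i)) => [lti|]; last by lia.
by rewrite a0 ?inE // addn0 geq_minl.
Qed.

End Witness.

(** * Exponents in the polarized variables *)

Section Depolarize.
Variables (n : nat) (r : 'X_{1..n}).
Implicit Types (M : pred 'X_{1..n}) (i : 'I_n) (j : nat).
Local Open Scope nat_scope.

Definition pvar : finType := {i : 'I_n & 'I_(r i)}.
Implicit Types (b c : 'X_{1..#|pvar|}).

Definition pidx i (k : 'I_(r i)) : 'I_#|pvar| :=
  enum_rank (Tagged (fun i => 'I_(r i)) k : pvar).

(** Extending the exponents by 0 to all [j : nat] makes [j = r i] a position
  where every run of variables [x_{i,0}, x_{i,1}, ...] has stopped. *)
Definition pexp b i j : nat :=
  if insub j is Some k then b (@pidx i k) else 0.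

Lemma pexp_ord b i (k : 'I_(r i)) : pexp b i k = b (pidx k).
Proof. by rewrite /pexp valK. Qed.

Lemma pexp_out b i j : r i <= j -> pexp b i j = 0.
Proof. by move=> le; rewrite /pexp insubF // ltnNge le. Qed.

Lemma pexpD b c i j : pexp (b + c)%MM i j = pexp b i j + pexp c i j.
Proof. by rewrite /pexp; case: insub => // k; rewrite mnmDE. Qed.

Lemma pidxP (t : 'I_#|pvar|) : exists i (k : 'I_(r i)), t = pidx k.
Proof.
case E: (enum_val t) => [i k]; exists i, k.
by apply: enum_val_inj; rewrite enum_rankK E.
Qed.

Lemma pidx_eq i i' (k : 'I_(r i)) (k' : 'I_(r i')) :
  (pidx k == pidx k') = (i == i') && (k == k' :> nat).
Proof.
rewrite (inj_eq enum_rank_inj); case: (eqVneq i i') => [ii'|ne] /=.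
  by subst i'; rewrite -tag_eqE /tag_eq /= eqxx tagged_asE.
by rewrite -tag_eqE /tag_eq /= (negbTE ne).
Qed.

Lemma pexpU i (k : 'I_(r i)) i' j :
  pexp U_(pidx k) i' j = (i == i') && (k == j :> nat).
Proof.
rewrite /pexp; case: insubP => [k' _ <-|]; first by rewrite mnm1E pidx_eq.
by rewrite -leqNgt; case: eqVneq => //= <-; case: eqP => // <-; rewrite leqNgt ltn_ord.
Qed.

Definition pbuild (g : 'I_n -> nat -> nat) : 'X_{1..#|pvar|} :=
  [multinom g (tag (enum_val t)) (tagged (enum_val t)) | t < #|pvar|].

Lemma pbuildE g i j : pexp (pbuild g) i j = if j < r i then g i j else 0.
Proof.
rewrite /pexp; case: insubP => [k -> <-|/negbTE->//].
by rewrite mnmE /pidx enum_rankK.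
Qed.

Definition coldeg b i := \sum_(j < r i) pexp b i j.

Lemma mdeg_coldeg b : mdeg b = \sum_i coldeg b i.
Proof.
rewrite mdegE (reindex (@enum_rank pvar)) /=; last first.
  by apply: onW_bij; apply: enum_rank_bij.
rewrite [RHS](eq_bigr (fun i => \sum_(k < r i) b (pidx k))); last first.
  by move=> i _; apply: eq_bigr => k _; rewrite pexp_ord.
by rewrite sig_big_dep /=; apply: eq_bigr => -[].
Qed.

Lemma depol_subproof b i : exists j, pexp b i j == 0.
Proof. by exists (r i); rewrite pexp_out. Qed.

(** The length of the initial run of [x_{i,0}, x_{i,1}, ...] dividing [y^b]. *)
Definition depol b : 'X_{1..n} := [multinom ex_minn (depol_subproof b i) | i < n].

Lemma leq_depol b i (c : nat) : (c <= depol b i) <-> (forall j, j < c -> 0 < pexp b i j).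
Proof.
rewrite mnmE; case: ex_minnP => m /eqP m0 mmin; split=> [cm j jc|H].
  by rewrite lt0n; apply/negP => /mmin; lia.
by rewrite leqNgt; apply/negP => /H; rewrite m0.
Qed.

Lemma pexp_depol b i : pexp b i (depol b i) = 0.
Proof. by rewrite mnmE; case: ex_minnP => m /eqP. Qed.

Lemma depol_le b i j : pexp b i j = 0 -> depol b i <= j.
Proof.
by move=> b0; rewrite leqNgt; apply/negP => /leq_depol/(_ j (ltnSn j)); rewrite b0.
Qed.

Lemma sum_initial (c m : nat) : \sum_(j < m) (j < c) = minn c m.
Proof. by elim: m => [|m IHm]; rewrite ?big_ord0 ?big_ord_recr /= ?IHm; lia. Qed.

Lemma depol_le_coldeg b i : depol b i <= coldeg b i.
Proof.
have le : depol b i <= r i by apply: depol_le; rewrite pexp_out.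
rewrite -(minn_idPl le) -sum_initial; apply: leq_sum => j _.
by case: ltnP => // ltj; move: (leqnn (depol b i)) => /leq_depol; apply.
Qed.

Lemma depol_mono b c i : (forall j, pexp b i j <= pexp c i j) -> depol b i <= depol c i.
Proof.
move=> le; apply/leq_depol => j ltj; apply: leq_trans (le j).
by move: (leqnn (depol b i)) => /leq_depol; apply.
Qed.

Lemma coldeg_mul_var b i (k : 'I_(r i)) : coldeg (b + U_(pidx k))%MM i = (coldeg b i).+1.
Proof.
rewrite /coldeg (eq_bigr (fun j : 'I_(r i) => pexp b i j + (k == j :> nat))); last first.
  by move=> j _; rewrite pexpD pexpU eqxx.
rewrite big_split /= [X in _ + X](bigD1 k) //= eqxx.
rewrite [X in _ + (_ + X)]big1 ?addn0 ?addn1 // => j.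
by rewrite eq_sym -val_eqE => /negbTE ->.
Qed.

(** Since the run of [b] in row [i] stops at [u i] or at [r i], multiplying by
  [x_{i,u_i}] lengthens it by one, and multiplying by the other variables of
  the row leaves it unchanged. *)
Lemma polarize_witness M u S : closed_mod r M -> witness M u S ->
  exists b T, witness (M \o depol) b T /\ mdeg b <= mdeg u.
Proof.
move=> cM [MS MnS].
pose b := pbuild (fun i j => j < u i).
pose T := [set t | [exists i in S,
  [exists k : 'I_(r i), (t == pidx k) && (k == u i :> nat)]]].
exists b, T; split; [split=> [t|c c0] /=|].
- rewrite inE => /existsP[i /andP[iS /existsP[k /andP[/eqP-> /eqP ku]]]].
  apply: cM (MS i iS) => i'; apply/leq_depol => j; rewrite leq_min mnmDE mnm1E.
  case/andP=> jlt jr; rewrite pexpD pexpU pbuildE jr; move: jlt.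
  case: (eqVneq i i') => [<-|_] /=; first by lia.
  by lia.
- pose a : 'X_{1..n} := [multinom (if i \in S then 0 else depol (b + c)%MM i) | i < n].
  have : ~~ M (u + a)%MM by apply: MnS => i iS; rewrite mnmE iS.
  apply: contra; apply: cM => i; rewrite geq_min mnmDE [a i]mnmE.
  case: ifP => iS; last by rewrite leq_addl.
  apply/orP; left; rewrite addn0; apply: depol_le.
  rewrite pexpD pbuildE ltnn if_same add0n.
  rewrite /pexp; case: insubP => // k _ ku; apply: c0.
  rewrite inE; apply/existsP; exists i; rewrite iS.
  by apply/existsP; exists k; rewrite ku !eqxx.
- rewrite mdeg_coldeg mdegE; apply: leq_sum => i _.
  rewrite /coldeg (eq_bigr (fun j : 'I_(r i) => (j < u i) : nat)); last first.
    by move=> j _; rewrite pbuildE ltn_ord.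
  by rewrite sum_initial geq_minl.
Qed.

(** The hypothesis on pairs of witnesses says that no associated prime
  of the monomial ideal [M] strictly contains another. *)
Lemma depolarize_witness M b T : closed_mod r M ->
    (forall u v S S', witness M u S -> witness M v S' -> S \subset S' -> S = S') ->
    witness (M \o depol) b T ->
  exists u S, witness M u S /\ mdeg u <= mdeg b.
Proof.
move=> cM unmixed [NT NnT].
have cl v w := @closed_mod_le _ _ _ v w cM.
have Mdep : ~~ M (depol b) by have := witness_notin (conj NT NnT).
(* A variable elsewhere in row [i] does not change the run. *)
have T_first i (k : 'I_(r i)) : pidx k \in T -> k = depol b i :> nat.
  move=> kT; apply/eqP; apply: contraNT Mdep => ne.
  apply: cl (NT _ kT); apply/mnm_lepP => i'; apply: depol_le.
  rewrite pexpD pexp_depol pexpU; case: (eqVneq i i') => //= ii'.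
  by subst i'; rewrite (negbTE ne).
pose S := [set i | [exists k : 'I_(r i), pidx k \in T]].
(* Multiplying [b] by one variable of row [i] gives a run of length at most
   [coldeg b i + 1], hence the power of [x_i] that works above [depol b]. *)
have MS u i : i \in S -> (depol b <= u)%MM -> coldeg b i < u i -> M u.
  rewrite inE => /existsP[k kT] /mnm_lepP depu ltu.
  apply: cl (NT _ kT); apply/mnm_lepP => i'.
  case: (eqVneq i i') => [<-|ne].
    by apply: leq_trans (depol_le_coldeg _ _) _; rewrite coldeg_mul_var.
  apply: leq_trans (depu i'); apply: depol_mono => j.
  by rewrite pexpD pexpU (negbTE ne) addn0.
have MnS (a : 'X_{1..n}) : (forall i, i \in S -> a i = 0) -> ~~ M (depol b + a)%MM.
  (* Fill every row outside [S], and row [i] in [S] except at [depol b i]. *)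
  move=> a0; pose c := pbuild (fun i j => (j != depol b i) || (i \notin S)).
  apply: contra (NnT c _); last first.
    move=> t tT; have [i [k tE]] := pidxP t; subst t.
    rewrite -pexp_ord pbuildE ltn_ord (T_first _ _ tT) eqxx /=.
    suff -> : i \in S by [].
    by rewrite inE; apply/existsP; exists k.
  rewrite /=; apply: cM => i; apply/leq_depol => j; rewrite leq_min mnmDE => /andP[ltj jr].
  rewrite pexpD pbuildE jr.
  case: (boolP (i \in S)) => [iS|_]; last by rewrite orbT addn1.
  by move: ltj; rewrite (a0 _ iS) addn0 => ltj; rewrite orbF; lia.
(* Primes over the colon ideal of [depol b] contain the variables in [S]. *)
have sub_S v S' : (depol b <= v)%MM -> witness M v S' -> S \subset S'.
  move=> depv [MS' MnS']; apply/subsetP => i iS; apply/negbNE/negP => iS'.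
  have /negP : ~~ M (v + U_(i) *+ (coldeg b i).+1)%MM.
    apply: MnS' => k kS'; rewrite mulmnE mnm1E; case: eqP => [ik|//].
    by rewrite ik kS' in iS'.
  apply; apply: (MS _ i iS); first exact: lepm_trans depv (lem_addr _ _).
  by rewrite mnmDE mulmnE mnm1E eqxx mul1n; lia.
(* The prime of [S] is associated: push the coordinates outside [S] up to [r],
   so that no witness above can involve them. *)
have [w wS] : exists w, witness M w S.
  pose a : 'X_{1..n} := [multinom (if i \in S then 0 else r i) | i < n].
  have [|w [S' [le_w wit]]] := @witness_above _ _ _ (depol b + a)%MM cM.
    by apply: MnS => i iS; rewrite mnmE iS.
  exists w; suff -> : S = S' by [].
  apply/eqP; rewrite eqEsubset (sub_S _ _ _ wit) /=; last first.
    exact: lepm_trans (lem_addr _ _) le_w.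
  apply/subsetP => i iS'; apply: contraNT (witness_notin wit) => iS.
  case: (wit) => MS' _; apply: cM (MS' _ iS') => k; rewrite mnmDE mnm1E.
  case: (eqVneq i k) => [<-|_]; last by lia.
  by have := mnm_lepP le_w i; rewrite mnmDE [a i]mnmE (negbTE iS); lia.
(* The colon ideal of [depol b] is primary, for want of embedded primes. *)
have primary (v a : 'X_{1..n}) : (depol b <= v)%MM -> ~~ M v ->
    (forall i, i \in S -> a i = 0) -> ~~ M (v + a)%MM.
  move=> depv Mv a0; have [v' [S' [vv' wit]]] := witness_above cM Mv.
  have SS' : S = S'.
    by apply: (unmixed _ _ _ _ wS wit); apply: sub_S wit; apply: lepm_trans vv'.
  have [_ /(_ a)] := wit; rewrite -SS' => /(_ a0); apply: contra; apply: cl.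
  by apply/mnm_lepP => i; rewrite !mnmDE leq_add2r; apply: (mnm_lepP vv').
have [|u [depu ub Mu umax]] :=
  @box_maximal _ (fun u => ~~ M u) (depol b) [multinom coldeg b i | i < n] _ Mdep.
  by apply/mnm_lepP => i; rewrite mnmE depol_le_coldeg.
exists u, S; split; [split=> [i iS|a a0]|].
- case: (ltnP (u i) (coldeg b i)) => ltu.
    by apply/negbNE/umax; rewrite mnmE.
  apply: (MS _ i iS); first exact: lepm_trans depu (lem_addr _ _).
  by rewrite mnmDE mnm1E eqxx addn1.
- exact: primary.
- rewrite mdeg_coldeg mdegE; apply: leq_sum => i _.
  by have := mnm_lepP ub i; rewrite mnmE.
Qed.

End Depolarize.

(** * Finite generation of monomial ideals *)

Section Dickson.
Variable n : nat.
Local Open Scope nat_scope.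

(** Comparing only the coordinates in [s] allows induction on [s].  Let [G0]
  be a basis for the coordinates in [s] and [N] bound its [i]-th exponents: it
  also dominates the vectors of [A] with [a i >= N], and each of the finitely
  many slices [a i = c < N] has its own basis. *)
Lemma dickson_on (s : seq 'I_n) (A : 'X_{1..n} -> Prop) :
  exists G : seq 'X_{1..n}, {in G, forall g, A g} /\
    forall a, A a -> exists2 g, g \in G & {in s, forall i, g i <= a i}.
Proof.
elim: s A => [|i s IHs] A.
  case: (pselect (exists a, A a)) => [[a Aa]|nA]; last first.
    by exists [::]; split=> // a Aa; case: nA; exists a.
  exists [:: a]; split=> [g|b _]; first by rewrite inE => /eqP->.
  by exists a; rewrite ?inE.
have [G0 [G0A G0b]] := IHs A.
pose N := \max_(g <- G0) g i.
have /choice[G HG] (c : nat) := IHs (fun a => A a /\ a i = c).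
exists (G0 ++ flatten [seq G c | c <- iota 0 N]); split=> [g|a Aa].
  rewrite mem_cat => /orP[/G0A//|/flatten_mapP[c _ gG]].
  by case: (HG c) => /(_ g gG)[].
case: (ltnP (a i) N) => [ltN|leN].
  have [GA /(_ a (conj Aa erefl))[g gG le]] := HG (a i).
  exists g; first by rewrite mem_cat; apply/orP; right; apply/flatten_mapP;
    exists (a i); rewrite ?mem_iota.
  by move=> k; rewrite inE => /orP[/eqP->|/le//]; case: (GA _ gG) => _ ->.
have [g gG le] := G0b a Aa.
exists g; first by rewrite mem_cat gG.
move=> k; rewrite inE => /orP[/eqP->|/le//]; apply: leq_trans leN.
by rewrite /N (big_rem g) //= leq_maxl.
Qed.

Lemma dickson (A : 'X_{1..n} -> Prop) :
  exists G : seq 'X_{1..n}, {in G, forall g, A g} /\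
    forall a, A a -> exists2 g, g \in G & (g <= a)%MM.
Proof.
have [G [GA Gb]] := dickson_on (enum 'I_n) A; exists G; split=> // a /Gb[g gG le].
by exists g => //; apply/mnm_lepP => i; apply: le; rewrite mem_enum.
Qed.

End Dickson.

(** * Membership and colons in monomial ideals *)

Section MonomialIdeals.
Variables (K : fieldType) (n : nat).
Implicit Types (I P : {pred {mpoly K[n]}}) (f p : {mpoly K[n]}) (G : seq 'X_{1..n}).

Definition mons I : pred 'X_{1..n} := fun m => 'X_[m] \in I.

Definition termwise I := forall p, (p \in I) = all (mons I) (msupp p).

Lemma ideal_gen_monomials (A : {pred {mpoly K[n]}}) p :
    (forall u, u \in A -> exists m : 'X_{1..n}, u = 'X_[m]) ->
  p \in ideal_gen A <->
  {in msupp p, forall m, exists2 g, 'X_[g] \in A & (g <= m)%MM}.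
Proof.
move=> monA; split=> [/asboolP[s [sA ->]]|H].
  move=> m /msupp_sum_le/flattenP[l /mapP[c]].
  rewrite mem_filter /= => cs ->; have [g cE] := monA _ (sA _ cs).
  rewrite cE (perm_mem (msuppMX _ _)) => /mapP[m' _ ->].
  by exists g; rewrite -?cE ?sA // lem_addr.
have /choice[g Hg] : forall m, exists g, m \in msupp p -> 'X_[g] \in A /\ (g <= m)%MM.
  move=> m; case: (boolP (m \in msupp p)) => [/H[g gA gm]|_]; first by exists g.
  by exists m.
apply/asboolP; exists [seq (p@_m *: 'X_[m - g m], 'X_[g m]) | m <- msupp p]; split.
  by move=> _ /mapP[m mp ->] /=; case: (Hg m mp).
rewrite big_map {1}[p]mpolyE big_seq [RHS]big_seq; apply: eq_bigr => m mp /=.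
by rewrite -scalerAl -mpolyXD submK //; case: (Hg m mp).
Qed.

Lemma mem_ideal_gen_mpolyX G p :
  (p \in ideal_gen (mem [seq 'X_[m] : {mpoly K[n]} | m <- G])) =
  all (fun m => has (fun g => g <= m)%MM G) (msupp p).
Proof.
have monG u : u \in [seq 'X_[m] : {mpoly K[n]} | m <- G] ->
    exists m : 'X_{1..n}, u = 'X_[m].
  by move=> /mapP[m _ ->]; exists m.
apply/idP/allP => [/(ideal_gen_monomials _ monG) H m /H[g] | H].
  move=> /mapP[g' g'G E] gm; apply/hasP; exists g => //.
  have : g \in msupp ('X_[g'] : {mpoly K[n]}) by rewrite -E msuppX inE.
  by rewrite msuppX inE => /eqP->.
apply/(ideal_gen_monomials _ monG) => m /H/hasP[g gG gm].
by exists g => //; apply/mapP; exists g.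
Qed.

Section Generated.
Variables (G : seq 'X_{1..n}) (I : {pred {mpoly K[n]}}).
Hypothesis genI : generates G I.

Lemma mons_generates m : mons I m = has (fun g => g <= m)%MM G.
Proof. by rewrite /mons genI mem_ideal_gen_mpolyX msuppX /= andbT. Qed.

Lemma termwise_generates : termwise I.
Proof.
by move=> p; rewrite genI mem_ideal_gen_mpolyX; apply: eq_all => m; rewrite mons_generates.
Qed.

Lemma lem_big_mlcm g : g \in G -> (g <= \big[@mlcm n/0%MM]_(m <- G) m)%MM.
Proof.
elim: G => // a G' IH; rewrite inE big_cons => /orP[/eqP->|/IH le].
  exact: lem_mlcml.
exact: lepm_trans le (lem_mlcmr _ _).
Qed.

Lemma closed_mod_generates : closed_mod (\big[@mlcm n/0%MM]_(m <- G) m) (mons I).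
Proof.
move=> u v le; rewrite !mons_generates => /hasP[g gG /mnm_lepP gu].
apply/hasP; exists g => //; apply/mnm_lepP => i; apply: leq_trans (le i).
by rewrite leq_min gu (mnm_lepP (lem_big_mlcm gG)).
Qed.

End Generated.

(** Dickson's lemma gives a finite generating set; one of least size is
  irredundant. *)
Lemma min_gens_generates I : monomial_ideal I -> generates (min_gens I) I.
Proof.
move=> [A [monA AI]]; rewrite /min_gens; case: pselect => [ex|[]].
  by case: (projT2 (cid ex)).
have [G0 [G0A G0b]] := dickson (fun m => ('X_[m] : {mpoly K[n]}) \in A).
have gen0 : generates G0 I.
  move=> p; rewrite AI mem_ideal_gen_mpolyX; apply/idP/allP => [|H].
    move=> /(ideal_gen_monomials _ monA) H m /H[a /G0b[g gG ga] am].
    by apply/hasP; exists g => //; apply: lepm_trans am.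
  apply/(ideal_gen_monomials _ monA) => m /H/hasP[g gG gm].
  by exists g => //; apply: G0A.
have ex : exists k, `[< exists G, size G = k /\ generates G I >].
  by exists (size G0); apply/asboolP; exists G0.
case: (ex_minnP ex) => k /asboolP[G [sG genG]] kmin.
have gen_mem (G1 G2 : seq 'X_{1..n}) : G1 =i G2 -> generates G1 I -> generates G2 I.
  move=> eqG gen1 p; rewrite gen1 !mem_ideal_gen_mpolyX; apply: eq_all => m.
  by rewrite (eq_has_r eqG).
have min_size G' : generates G' I -> (k <= size G')%N.
  by move=> genG'; apply: kmin; apply/asboolP; exists G'.
have uG : uniq G.
  rewrite -[uniq G]negbK -ltn_size_undup -leqNgt sG; apply: min_size.
  by apply: gen_mem genG => x; rewrite mem_undup.
exists G; split=> // G' G'G genG' x xG.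
have genU : generates (undup G') I by apply: gen_mem genG' => y; rewrite mem_undup.
have sub : {subset undup G' <= G} by move=> y; rewrite mem_undup; apply: G'G.
have [|_ eqG] := uniq_min_size (undup_uniq G') sub; first by rewrite sG min_size.
by rewrite -mem_undup eqG.
Qed.

Definition meets (S : {set 'I_n}) (m : 'X_{1..n}) := [exists i in S, m i != 0%N].

Lemma meetsPn (S : {set 'I_n}) (m : 'X_{1..n}) :
  reflect (forall i, i \in S -> m i = 0%N) (~~ meets S m).
Proof.
rewrite negb_exists_in; apply: (iffP forall_inP) => H i iS.
  by apply/eqP; rewrite -[_ == _]negbK H.
by rewrite H.
Qed.

(** The ideal generated by the variables in [S], by its membership criterion. *)
Definition var_ideal (S : {set 'I_n}) : {pred {mpoly K[n]}} :=
  [pred p : {mpoly K[n]} | all (meets S) (msupp p)].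

Definition kill_vars (S : {set 'I_n}) : n.-tuple {mpoly K[n]} :=
  [tuple (if i \in S then 0 else 'X_i) | i < n].

Lemma mcoeff_kill_vars S p m :
  (p \mPo kill_vars S)@_m = if meets S m then 0 else p@_m.
Proof.
have killX (k : 'X_{1..n}) :
    'X_[k] \mPo kill_vars S = if meets S k then 0 else 'X_[k] :> {mpoly K[n]}.
  rewrite comp_mpolyX; case: ifPn => [/exists_inP[i iS ki]|/meetsPn k0].
    by rewrite (bigD1 i) //= tnth_mktuple iS expr0n (negbTE ki) mul0r.
  rewrite mpolyXE_id; apply: eq_bigr => i _; rewrite tnth_mktuple.
  by case: ifP => // /k0->; rewrite !expr0.
rewrite comp_mpolyEX (raddf_sum (mcoeff m)) /=; case: ifP => mS.
  apply: big1 => k _; rewrite mcoeffZ killX; case: ifPn => kS.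
    by rewrite mcoeff0 mulr0.
  by rewrite mcoeffX; case: eqP kS => [->|_]; rewrite ?mS ?mulr0.
rewrite [in RHS](mpolyE p) (raddf_sum (mcoeff m)) /=.
apply: eq_bigr => k _; rewrite !mcoeffZ killX.
by case: ifP => // kS; rewrite mcoeff0 mcoeffX; case: eqP kS => [->|]; rewrite ?mS.
Qed.

(** Being the kernel of an endomorphism of a domain, [var_ideal S] is prime. *)
Lemma var_idealE S p : (p \in var_ideal S) = (p \mPo kill_vars S == 0).
Proof.
apply/allP/eqP => [H|H m].
  apply/mpolyP => m; rewrite mcoeff_kill_vars mcoeff0; case: ifPn => // mS.
  by apply: memN_msupp_eq0; apply: contra mS; apply: H.
rewrite mcoeff_msupp; have := mcoeff_kill_vars S p m.
by rewrite H mcoeff0; case: ifP => // _ <-; rewrite eqxx.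
Qed.

Lemma var_ideal_prime S : prime_ideal (var_ideal S).
Proof.
split; last by move=> p q; rewrite !var_idealE rmorphM mulf_eq0.
split=> [||a p q]; rewrite !var_idealE ?rmorph0 ?rmorph1 ?oner_eq0 //.
by move=> /eqP p0 /eqP q0; rewrite rmorphD rmorphM /= p0 q0 mulr0 addr0.
Qed.

Lemma var_idealX S i : ('X_i \in var_ideal S) = (i \in S).
Proof.
rewrite inE msuppX /= andbT; apply/exists_inP/idP => [[j jS]|iS].
  by rewrite mnm1E; case: (eqVneq i j) => [->|].
by exists i; rewrite // mnm1E eqxx.
Qed.

Lemma prime_monomial P (m : 'X_{1..n}) : prime_ideal P -> 'X_[m] \in P ->
  exists2 i, m i != 0%N & 'X_i \in P.
Proof.
move=> [[_ P1 _] primeP]; rewrite mpolyXE_id.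
have powP q k : q ^+ k \in P -> k != 0%N /\ q \in P.
  elim: k => [|k IHk]; first by rewrite expr0 (negbTE P1).
  by rewrite exprS => /primeP/orP[|/IHk[]].
elim: (index_enum _) => [|i s IHs].
  by rewrite big_nil (negbTE P1).
rewrite big_cons.
by move=> /primeP/orP[/powP[]|//]; exists i.
Qed.

Lemma colon_mpolyX I (r u : 'X_{1..n}) S :
    termwise I -> closed_mod r (mons I) -> witness (mons I) u S ->
  colon I 'X_[u] =i var_ideal S.
Proof.
move=> tI cI [IS InS] p; rewrite inE tI (perm_all _ (msuppMX _ _)) all_map.
apply: eq_all => m /=; apply/idP/idP => [Ium|/exists_inP[i iS mi]].
  by apply: contraLR Ium => /meetsPn; apply: InS.
apply: closed_mod_le cI _ (IS i iS); apply/mnm_lepP => j.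
by rewrite !mnmDE mnm1E leq_add2l; case: eqP => // <-; rewrite lt0n.
Qed.

Lemma var_ideal_assoc I (r u : 'X_{1..n}) S :
    termwise I -> closed_mod r (mons I) -> witness (mons I) u S ->
  assoc_prime I (var_ideal S).
Proof.
move=> tI cI wit; split; first exact: var_ideal_prime.
by exists 'X_[u] => p; rewrite (colon_mpolyX tI cI wit).
Qed.

(** With [S] the variables in [P], every monomial of [f] satisfies the first half
  of [witness].  If all failed the second half, multiplying together the
  monomials that show it would give a monomial of the prime [P], hence a
  variable of [P], among the variables outside [S]. *)
Lemma witness_of_colon I (r : 'X_{1..n}) P f :
    termwise I -> closed_mod r (mons I) -> prime_ideal P -> colon I f =i P ->
  exists u S, u \in msupp f /\ witness (mons I) u S.
Proof.
move=> tI cI primeP fP.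
have mulX a : ('X_[a] \in P) = all (fun m => mons I (m + a)%MM) (msupp f).
  rewrite -fP inE mulrC tI (perm_all _ (msuppMX _ _)) all_map.
  by apply: eq_all => m /=; rewrite addmC.
pose S := [set i : 'I_n | ('X_i : {mpoly K[n]}) \in P].
suff [u uf uS] : exists2 u, u \in msupp f &
    forall a : 'X_{1..n}, (forall i, i \in S -> a i = 0%N) -> ~~ mons I (u + a)%MM.
  exists u, S; split=> //; split=> // i.
  by rewrite inE mulX => /allP; apply.
apply: contrapT => nex.
have /choice[a aP] : forall m, exists a : 'X_{1..n}, m \in msupp f ->
    (forall i, i \in S -> a i = 0%N) /\ mons I (m + a)%MM.
  move=> m; apply: contrapT => na; apply: nex.
  exists m; first by apply: contrapT => nm; apply: na; exists 0%MM => /nm.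
  by move=> a a0; apply/negP => Ia; apply: na; exists a.
pose A := (\sum_(m <- msupp f) a m)%MM.
have AP : 'X_[A] \in P.
  rewrite mulX; apply/allP => m mf; have [_] := aP m mf.
  apply: (closed_mod_le cI); apply/mnm_lepP => i; rewrite !mnmDE leq_add2l.
  by apply: (mnm_lepP _ i); rewrite /A (big_rem m) //= lem_addr.
have [i Ai iP] := prime_monomial primeP AP.
have iS : i \in S by rewrite inE.
case/eqP: Ai; rewrite /A mnm_sumE big_seq big1 // => m mf.
by have [->] := aP m mf.
Qed.

Lemma v_degreeP I (r : 'X_{1..n}) d : termwise I -> closed_mod r (mons I) ->
  v_degree I d <-> exists u S, witness (mons I) u S /\ mdeg u = d.
Proof.
move=> tI cI; split=> [/asboolP[f [P [homf [primeP _] fP]]]|[u [S [wit du]]]].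
  have [u [S [uf wit]]] := witness_of_colon tI cI primeP fP.
  by exists u, S; split=> //; apply: (dhomogP _ _ _ homf).
apply/asboolP; exists 'X_[u], (var_ideal S); split.
- by rewrite dhomogX; apply/eqP.
- exact: var_ideal_assoc tI cI wit.
- exact: colon_mpolyX tI cI wit.
Qed.

Lemma v_number_witness I (r u0 : 'X_{1..n}) S0 :
    termwise I -> closed_mod r (mons I) -> witness (mons I) u0 S0 ->
  (exists u S, witness (mons I) u S /\ mdeg u = v_number I) /\
  (forall u S, witness (mons I) u S -> (v_number I <= mdeg u)%N).
Proof.
move=> tI cI wit0; rewrite /v_number; case: pselect => [ex|[]]; last first.
  by exists (mdeg u0); apply/(v_degreeP _ tI cI); exists u0, S0.
case: ex_minnP => d /(v_degreeP _ tI cI) wit dmin; split=> // u S witu.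
by apply: dmin; apply/(v_degreeP _ tI cI); exists u, S.
Qed.

End MonomialIdeals.

(** * Polarization *)

Section Polarization.
Variables (K : fieldType) (n : nat) (I : {pred {mpoly K[n]}}).

Definition pol_expo (m : 'X_{1..n}) : 'X_{1..#|pol_var I|} :=
  pbuild (gens_lcm I) (fun i j => (j < m i)%N).

Lemma pol_monomialE m : pol_monomial I m = 'X_[pol_expo m].
Proof.
rewrite mpolyXE_id (reindex (@enum_rank (pvar (gens_lcm I)))) /=; last first.
  by apply: onW_bij; apply: enum_rank_bij.
rewrite /pol_monomial (eq_bigr (fun i => \prod_(j < gens_lcm I i)
    'X_(pidx j) ^+ pol_expo m (pidx j))); last first.
  move=> i _; rewrite big_mkcond; apply: eq_bigr => j _.
  by rewrite -pexp_ord pbuildE ltn_ord; case: ltnP.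
by rewrite sig_big_dep /=; apply: eq_bigr => -[].
Qed.

Lemma polarization_generates :
  generates [seq pol_expo m | m <- min_gens I] (polarization I).
Proof.
move=> p; rewrite /polarization -map_comp.
by congr (p \in ideal_gen (mem _)); apply: eq_map => m; apply: pol_monomialE.
Qed.

(** The polarization of [x^g] divides [y^b] iff the run of [b] in each row [i]
  has length at least [g i]. *)
Lemma mons_polarization : monomial_ideal I ->
  mons (polarization I) =1 mons I \o @depol n (gens_lcm I).
Proof.
move=> monI b; rewrite (mons_generates polarization_generates) has_map /=.
rewrite (mons_generates (min_gens_generates monI)).
apply: eq_in_has => g gG /=; have gr := mnm_lepP (lem_big_mlcm gG).
apply/mnm_lepP/mnm_lepP => [le i|le t].
  apply/leq_depol => j ltj; have ltr : (j < gens_lcm I i)%N := leq_trans ltj (gr i).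
  have := le (pidx (Ordinal ltr)); rewrite -!pexp_ord pbuildE /= ltr ltj.
  exact.
have [i [k ->]] := pidxP t; rewrite -!pexp_ord pbuildE ltn_ord.
by case: ltnP => // ltk; move: (le i) => /leq_depol/(_ _ ltk).
Qed.

End Polarization.

Lemma eq_witness n (M N : pred 'X_{1..n}) u S : M =1 N ->
  witness M u S -> witness N u S.
Proof.
move=> MN [MS MnS]; split=> [i /MS|a /MnS]; by rewrite MN.
Qed.

Theorem corollary3p5 (K : fieldType) (n : nat) (I : {pred {mpoly K[n]}})
    (monI : monomial_ideal I) (properI : 1 \notin I) :
  (v_number (polarization I) <= v_number I)%N /\
  ((forall P : {pred {mpoly K[n]}}, ~ embedded_prime I P) ->
   v_number (polarization I) = v_number I).
Proof.
have genI := min_gens_generates monI.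
have tI := termwise_generates genI.
have cI : closed_mod (gens_lcm I) (mons I) := closed_mod_generates genI.
have genJ := @polarization_generates K n I.
have tJ := termwise_generates genJ.
have cJ := closed_mod_generates genJ.
have EJ := mons_polarization monI.
(* Some witness exists, so neither v-number is a default value. *)
have [|u0 [S0 [_ wit0]]] := witness_above (w := 0%MM) cI.
  by rewrite /mons mpolyX0.
have [[u [S [wit du]]] vI_le] := v_number_witness tI cI wit0.
have [b [T [/(eq_witness (fsym EJ)) witb leb]]] := polarize_witness cI wit.
have [[c [U [witc dc]]] vJ_le] := v_number_witness tJ cJ witb.
have vJI : (v_number (polarization I) <= v_number I)%N.
  by rewrite -du; apply: leq_trans leb; apply: vJ_le witb.
split=> // noemb; apply/eqP; rewrite eqn_leq vJI /=.
have [v v2 S1 S2 wit1 wit2 sub12|w [S1 [witw lew]]] :=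
  depolarize_witness cI _ (eq_witness EJ witc).
  have [_] : minimal_assoc_prime I (@var_ideal K n S2).
    apply: contrapT => nmin; apply: (noemb (@var_ideal K n S2)); split=> //.
    exact: var_ideal_assoc tI cI wit2.
  move=> /(_ _ (var_ideal_assoc tI cI wit1)) eqS.
  apply/setP => i; rewrite -!(@var_idealX K) eqS // => p /allP pS; apply/allP => m /pS.
  by case/exists_inP => k kS mk; apply/exists_inP; exists k => //; apply: (subsetP sub12).
by rewrite -dc; apply: leq_trans lew; apply: vI_le witw.
Qed.
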